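(* Let $\mathcal{RS}$ be a Riemann solver for a node $J$ with two incoming arcs (indices $1,2$) and two outgoing arcs (indices $3,4$), with flux $f$, and let $(\bar\rho_1,\bar\rho_2,\bar\rho_3,\bar\rho_4)$ be an equilibrium for $\mathcal{RS}$ with $\bar\rho_1\le\bar\rho_2$ and $\bar\rho_3\le\bar\rho_4$. Assume that the equilibrium is composed of four bad data. If $\mathcal F(\mathcal{RS}(\rho_{1,0},\dots,\rho_{4,0}),k)\ge0$ for every initial datum $(\rho_{1,0},\dots,\rho_{4,0})\in[0,1]^4$ and every $k\in[0,1]$, then $\bar\rho_1\le\bar\rho_2<\sigma<\bar\rho_3\le\bar\rho_4$. Moreover, if $\bar\rho_1\le\bar\rho_2<\sigma<\bar\rho_3\le\bar\rho_4$, then $\mathcal F(\bar\rho_1,\bar\rho_2,\bar\rho_3,\bar\rho_4,k)\ge0$ for every $k\in[0,1]$.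
   Context: Flux: $f:[0,1]\to\mathbb R$ is a continuous, piecewise smooth, concave function with $f(0)=f(1)=0$, and there is a unique $\sigma\in\,]0,1[$ such that $f$ is strictly increasing on $[0,\sigma[$ and strictly decreasing on $]\sigma,1]$. Let $\tau:[0,1]\to[0,1]$ be the map with $f(\tau(\rho))=f(\rho)$ for all $\rho\in[0,1]$ and $\tau(\rho)\neq\rho$ for all $\rho\ne\sigma$. Convention: $\mathrm{sgn}(0)=0$. Riemann solver (two incoming, two outgoing arcs): a function $\mathcal{RS}:[0,1]^4\to[0,1]^4$, $(\rho_{1,0},\dots,\rho_{4,0})\mapsto(\bar\rho_1,\dots,\bar\rho_4)$, such that for every initial datum: (1) $f(\bar\rho_1)+f(\bar\rho_2)=f(\bar\rho_3)+f(\bar\rho_4)$; (2) for $i\in\{1,2\}$ the classical Riemann problem for $\rho_t+f(\rho)_x=0$ with left state $\rho_{i,0}$ and right state $\bar\rho_i$ is solved with waves with negative speed; that is, $\bar\rho_i\in\{\rho_{i,0}\}\cup\,]\tau(\rho_{i,0}),1]$ if $\rho_{i,0}\le\sigma$ and $\bar\rho_i\in[\sigma,1]$ if $\rho_{i,0}\ge\sigma$; (3) for $j\in\{3,4\}$ the classical Riemann problem with left state $\bar\rho_j$ and right state $\rho_{j,0}$ is solved with waves with positive speed; that is, $\bar\rho_j\in[0,\sigma]$ if $\rho_{j,0}\le\sigma$ and $\bar\rho_j\in\{\rho_{j,0}\}\cup[0,\tau(\rho_{j,0})[$ if $\rho_{j,0}\ge\sigma$. An equilibrium for $\mathcal{RS}$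 is a fixed point of $\mathcal{RS}$. Good and bad data: a datum $\rho$ in an incoming arc is good if $\rho\in[\sigma,1]$ and bad if $\rho\in[0,\sigma[$; a datum $\rho$ in an outgoing arc is good if $\rho\in[0,\sigma]$ and bad if $\rho\in\,]\sigma,1]$. Entropy-flux function: $\mathcal F(\rho_1,\rho_2,\rho_3,\rho_4,k)=\sum_{i=1}^2\mathrm{sgn}(\rho_i-k)(f(\rho_i)-f(k))-\sum_{j=3}^4\mathrm{sgn}(\rho_j-k)(f(\rho_j)-f(k))$. (E1): $\mathcal{RS}$ satisfies (E1) if $\mathcal F(\mathcal{RS}(\rho_{1,0},\dots,\rho_{4,0}),k)\ge0$ for every initial datum $(\rho_{1,0},\dots,\rho_{4,0})\in[0,1]^4$ and every $k\in[0,1]$. *)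

(* Defs.v *)
From HB Require Import structures.
From mathcomp Require Import all_boot all_order all_algebra.
From mathcomp Require Import all_classical all_reals all_analysis.

Set Implicit Arguments.
Unset Strict Implicit.
Unset Printing Implicit Defensive.

Import Order.TTheory GRing.Theory Num.Theory.
Import numFieldNormedType.Exports.

Local Open Scope classical_set_scope.
Local Open Scope ring_scope.

Definition concave_function (R : realType) (D : set R) (f : R -> R) : Prop :=
  convex_function (E := R^o) D (fun x => - f x).

(* C^oo on an open interval: since the interval is open, the values there of
   the iterated derivatives do not depend on f outside of it. *)
Definition smooth_on_oo (R : realType) (a b : R) (f : R -> R) : Prop :=
  forall (n : nat) (x : R), x \in `]a, b[ -> derivable (derive1n n f) x 1.

(* For itv_partition a b s, the breakpoints are a :: s and the last one is b.
   Nothing is required of the derivatives at the breakpoints. *)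
Definition piecewise_smooth (R : realType) (a b : R) (f : R -> R) : Prop :=
  exists2 s : seq R, itv_partition a b s &
    forall i : nat, (i < size s)%N ->
      smooth_on_oo (nth b (a :: s) i) (nth b s i) f.

Definition unimodal_at (R : realType) (f : R -> R) (sigma : R) : Prop :=
  [/\ sigma \in `]0, 1[,
      {in `[0, sigma[ &, {homo f : x y / x < y}} &
      {in `]sigma, 1] &, {homo f : x y / x < y >-> x > y}}].

(* Functions on [0, 1] are represented by total functions on R, of which only
   the values on [0, 1] are constrained. *)
Record is_flux (R : realType) (f : R -> R) : Prop := IsFlux {
  flux_continuous : {within `[0, 1], continuous f};
  flux_piecewise_smooth : piecewise_smooth 0 1 f;
  flux_concave : concave_function `[0, 1] f;
  flux0 : f 0 = 0;
  flux1 : f 1 = 0;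
  flux_unimodal : exists! sigma : R, unimodal_at f sigma
}.

Record is_reflection (R : realType) (f : R -> R) (sigma : R) (tau : R -> R) :
    Prop := IsReflection {
  reflection_itv : {in `[0, 1], forall r, tau r \in `[0, 1]};
  reflection_flux : {in `[0, 1], forall r, f (tau r) = f r};
  reflection_neq : {in `[0, 1], forall r, r != sigma -> tau r != r}
}.

(* Arcs 1, 2 are incoming and arcs 3, 4 are outgoing; ordinals start at 0. *)
Definition arc1 : 'I_4 := @Ordinal 4 0 isT.
Definition arc2 : 'I_4 := @Ordinal 4 1 isT.
Definition arc3 : 'I_4 := @Ordinal 4 2 isT.
Definition arc4 : 'I_4 := @Ordinal 4 3 isT.

Definition incoming (i : 'I_4) : bool := (i < 2)%N.
Definition outgoing (i : 'I_4) : bool := ~~ incoming i.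

Definition in_cube (R : realType) (rho : 'rV[R]_4) : Prop :=
  forall i : 'I_4, rho 0 i \in `[0, 1].

(* Traces r for which the classical Riemann problem with left state r0 and
   right state r only has waves with negative speed. *)
Definition negative_speed (R : realType) (sigma : R) (tau : R -> R)
    (r0 r : R) : Prop :=
  (r0 <= sigma -> r = r0 \/ r \in `]tau r0, 1]) /\
  (sigma <= r0 -> r \in `[sigma, 1]).

(* Traces r for which the classical Riemann problem with left state r and
   right state r0 only has waves with positive speed. *)
Definition positive_speed (R : realType) (sigma : R) (tau : R -> R)
    (r0 r : R) : Prop :=
  (r0 <= sigma -> r \in `[0, sigma]) /\
  (sigma <= r0 -> r = r0 \/ r \in `[0, tau r0[).

Record is_riemann_solver (R : realType) (f : R -> R) (sigma : R)
    (tau : R -> R) (RS : 'rV[R]_4 -> 'rV[R]_4) : Prop := IsRiemannSolver {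
  rs_cube : forall rho0, in_cube rho0 -> in_cube (RS rho0);
  rs_conservation : forall rho0, in_cube rho0 ->
    f (RS rho0 0 arc1) + f (RS rho0 0 arc2) =
    f (RS rho0 0 arc3) + f (RS rho0 0 arc4);
  rs_incoming : forall rho0, in_cube rho0 -> forall i, incoming i ->
    negative_speed sigma tau (rho0 0 i) (RS rho0 0 i);
  rs_outgoing : forall rho0, in_cube rho0 -> forall j, outgoing j ->
    positive_speed sigma tau (rho0 0 j) (RS rho0 0 j)
}.

Definition equilibrium (R : realType) (RS : 'rV[R]_4 -> 'rV[R]_4)
    (rho : 'rV[R]_4) : Prop :=
  in_cube rho /\ RS rho = rho.

Definition bad_datum (R : realType) (sigma : R) (i : 'I_4) (r : R) : bool :=
  if incoming i then r \in `[0, sigma[ else r \in `]sigma, 1].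

Definition entropy_flux (R : realType) (f : R -> R) (rho : 'rV[R]_4) (k : R) :
    R :=
  \sum_(i | incoming i) Num.sg (rho 0 i - k) * (f (rho 0 i) - f k)
  - \sum_(j | outgoing j) Num.sg (rho 0 j - k) * (f (rho 0 j) - f k).

Definition entropy_E1 (R : realType) (f : R -> R)
    (RS : 'rV[R]_4 -> 'rV[R]_4) : Prop :=
  forall (rho0 : 'rV[R]_4) (k : R), in_cube rho0 -> k \in `[0, 1] ->
    0 <= entropy_flux f (RS rho0) k.

(* Main.v *)
Require Import Defs.
From mathcomp Require Import all_boot all_order all_algebra.
From mathcomp Require Import all_classical all_reals all_analysis.
From mathcomp Require Import lra.

Set Implicit Arguments.
Unset Strict Implicit.
Unset Printing Implicit Defensive.

Import Order.TTheory GRing.Theory Num.Theory.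
Import numFieldNormedType.Exports.

(** The first implication is read off from what bad data are: on an incoming arc
    they lie below [sigma], on an outgoing arc above it.

    For the second, conservation of the flux at the node says that the entropy
    flux would vanish if all its signs were [+], and also if all were [-].  When
    [k <= sigma], the outgoing data lie beyond [k] and carry the sign [+]; an
    incoming datum may carry the sign [-], but it lies with [k] on the increasing
    branch of [f], so the sign only turns [f (rho_i) - f k] into its absolute
    value.  The entropy flux is thus at least the sum with all signs [+].  When
    [sigma <= k], the roles are exchanged: the incoming data carry the sign [-],
    and an outgoing datum beyond [k] lies with [k] on the decreasing branch, so
    the entropy flux is at least the sum with all signs [-].

    The two cases meet at [k = sigma], where strict monotonicity on the half-open
    branches is not enough: continuity of [f] extends it, in weak form, to the
    closed branches (lemmas [unimodal_le_left] and [unimodal_ge_right]). *)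

Local Open Scope classical_set_scope.
Local Open Scope ring_scope.

(** Below [sigma] this is strict monotonicity; at [y = sigma] it is the limit of
    the inequalities [f x < f z] as [z] tends to [sigma] from the left. *)
Lemma unimodal_le_left (R : realType) (f : R -> R) (sigma x y : R) :
  unimodal_at f sigma -> f z @[z --> sigma] --> f sigma ->
  0 <= x -> x <= y -> y <= sigma -> f x <= f y.
Proof.
move=> [_ f_incr _] f_cont x0; rewrite le_eqVlt => /predU1P[->//|xy].
have f_lt z : x < z -> z < sigma -> f x < f z.
  move=> xz zs; apply: f_incr => //; rewrite in_itv /=.
    by rewrite x0 (lt_trans xz zs).
  by rewrite (le_trans x0 (ltW xz)).
rewrite le_eqVlt => /predU1P[ys|ys]; last exact/ltW/f_lt.
rewrite {y}ys in xy *.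
apply: (cvgr_to_ge (cvg_at_left_filter f_cont)).
near=> z; apply/ltW/f_lt; near: z; first exact: nbhs_left_gt.
exact: nbhs_left_lt.
Unshelve. all: by end_near. Qed.

(** The mirror image of [unimodal_le_left]; at [x = sigma] the limit is taken
    from the right. *)
Lemma unimodal_ge_right (R : realType) (f : R -> R) (sigma x y : R) :
  unimodal_at f sigma -> f z @[z --> sigma] --> f sigma ->
  sigma <= x -> x <= y -> y <= 1 -> f y <= f x.
Proof.
move=> [_ _ f_decr] f_cont sx; rewrite le_eqVlt => /predU1P[->//|xy] y1.
have f_lt z : sigma < z -> z < y -> f y < f z.
  move=> sz zy; apply: f_decr => //; rewrite in_itv /=.
    by rewrite sz (le_trans (ltW zy) y1).
  by rewrite (lt_trans sz zy).
move: sx; rewrite le_eqVlt => /predU1P[sx|sx]; last exact/ltW/f_lt.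
rewrite -{x}sx in xy *.
apply: (cvgr_to_ge (cvg_at_right_filter f_cont)).
near=> z; apply/ltW/f_lt; near: z; first exact: nbhs_right_gt.
exact: nbhs_right_lt.
Unshelve. all: by end_near. Qed.

(** The weak inequality suffices, although the sign is [0] at [x = k], because
    the factor [f x - f k] vanishes there too. *)
Lemma entropy_term_ge (R : realType) (f : R -> R) (x k : R) :
  k <= x -> Num.sg (x - k) * (f x - f k) = f x - f k.
Proof.
rewrite le_eqVlt => /predU1P[->|kx]; first by rewrite !subrr mulr0.
by rewrite gtr0_sg ?subr_gt0// mul1r.
Qed.

Lemma entropy_term_le (R : realType) (f : R -> R) (x k : R) :
  x <= k -> Num.sg (x - k) * (f x - f k) = f k - f x.
Proof.
rewrite le_eqVlt => /predU1P[->|xk]; first by rewrite !subrr mulr0.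
by rewrite ltr0_sg ?subr_lt0// mulN1r opprB.
Qed.

Lemma entropy_fluxE (R : realType) (f : R -> R) (rho : 'rV[R]_4) (k : R) :
  entropy_flux f rho k =
    Num.sg (rho 0 arc1 - k) * (f (rho 0 arc1) - f k)
    + Num.sg (rho 0 arc2 - k) * (f (rho 0 arc2) - f k)
    - (Num.sg (rho 0 arc3 - k) * (f (rho 0 arc3) - f k)
       + Num.sg (rho 0 arc4 - k) * (f (rho 0 arc4) - f k)).
Proof.
rewrite /entropy_flux (bigD1 arc1)// (bigD1 arc2)//= big1; last first.
  by case=> [[|[|[|[|]]]]].
rewrite (bigD1 arc3)// (bigD1 arc4)//= big1 ?addr0//.
by case=> [[|[|[|[|]]]]].
Qed.

Theorem proposition4p6 (R : realType) (f : R -> R) (sigma : R) (tau : R -> R)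
    (RS : 'rV[R]_4 -> 'rV[R]_4) (rho : 'rV[R]_4)
    (f_flux : is_flux f)
    (sigma_max : unimodal_at f sigma)
    (tau_refl : is_reflection f sigma tau)
    (RS_solver : is_riemann_solver f sigma tau RS)
    (rho_equilibrium : equilibrium RS rho)
    (rho_in_le : rho 0 arc1 <= rho 0 arc2)
    (rho_out_le : rho 0 arc3 <= rho 0 arc4)
    (rho_bad : forall i : 'I_4, bad_datum sigma i (rho 0 i)) :
  (entropy_E1 f RS ->
     [/\ rho 0 arc1 <= rho 0 arc2, rho 0 arc2 < sigma,
         sigma < rho 0 arc3 & rho 0 arc3 <= rho 0 arc4]) /\
  ([/\ rho 0 arc1 <= rho 0 arc2, rho 0 arc2 < sigma,
       sigma < rho 0 arc3 & rho 0 arc3 <= rho 0 arc4] ->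
     forall k : R, k \in `[0, 1] -> 0 <= entropy_flux f rho k).
Proof.
have [[rho_cube RS_rho] [sigma01 _ _]] := (rho_equilibrium, sigma_max).
have conserv : f (rho 0 arc1) + f (rho 0 arc2) = f (rho 0 arc3) + f (rho 0 arc4).
  by have := rs_conservation RS_solver rho_cube; rewrite RS_rho.
have f_cont : f z @[z --> sigma] --> f sigma.
  have /(continuous_within_itvP _ ltr01)[f_cont _ _] := flux_continuous f_flux.
  exact: f_cont.
have in_bad i : incoming i -> 0 <= rho 0 i /\ rho 0 i < sigma.
  by move=> ii; have := rho_bad i; rewrite /bad_datum ii in_itv => /andP[].
have out_bad j : outgoing j -> sigma < rho 0 j /\ rho 0 j <= 1.
  move=> /negPf jo; have := rho_bad j.
  by rewrite /bad_datum jo in_itv => /andP[].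
split=> [_|_ k]; first by split; [|exact: (in_bad _ _).2|exact: (out_bad _ _).1|].
rewrite in_itv /= entropy_fluxE => /andP[k0 k1].
have [ks|/ltW sk] := leP k sigma.
- have in_term i : incoming i ->
      f (rho 0 i) - f k <= Num.sg (rho 0 i - k) * (f (rho 0 i) - f k).
    move=> /in_bad[r0 /ltW rs]; have [kr|/ltW rk] := leP k (rho 0 i).
      by rewrite entropy_term_ge.
    rewrite entropy_term_le//.
    by have := unimodal_le_left sigma_max f_cont r0 rk ks; lra.
  have out_term j : outgoing j ->
      Num.sg (rho 0 j - k) * (f (rho 0 j) - f k) = f (rho 0 j) - f k.
    by move=> /out_bad[sr _]; rewrite entropy_term_ge// (le_trans ks (ltW sr)).
  rewrite (out_term arc3)// (out_term arc4)//.
  by have := in_term arc1 isT; have := in_term arc2 isT; move: conserv; lra.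
- have in_term i : incoming i ->
      Num.sg (rho 0 i - k) * (f (rho 0 i) - f k) = f k - f (rho 0 i).
    by move=> /in_bad[_ rs]; rewrite entropy_term_le// (le_trans (ltW rs) sk).
  have out_term j : outgoing j ->
      Num.sg (rho 0 j - k) * (f (rho 0 j) - f k) <= f k - f (rho 0 j).
    move=> /out_bad[/ltW sr r1]; have [kr|/ltW rk] := leP k (rho 0 j).
      rewrite entropy_term_ge//.
      by have := unimodal_ge_right sigma_max f_cont sk kr r1; lra.
    by rewrite entropy_term_le.
  rewrite (in_term arc1)// (in_term arc2)//.
  by have := out_term arc3 isT; have := out_term arc4 isT; move: conserv; lra.
Qed.
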